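(* Let $(\Gamma,\imath)$ be a (countably infinite) computable group and let $([F_n,\mathcal{Z}_n])_{n\geq1}$ be a computable Følner monotiling of $\Gamma$. Then there are a computable function $\mathbb{N}\to\Gamma$, $n\mapsto r_n$, and a computable function $\mathbb{N}\to\mathbb{N}$, $i\mapsto n_i$, such that $$\big([F_{n_i}r_{n_i}^{-1},\,r_{n_i}\mathcal{Z}_{n_i}]\big)_{i\geq1}$$ is a computable normal Følner monotiling.
   Context: Conventions. All groups are discrete and countably infinite; $\mathrm{e}$ is the identity; $|\cdot|$ is cardinality; $\mathbb{N}=\{1,2,\dots\}$. Computability of functions on natural numbers is the usual notion (Turing computability). A subset of $\mathbb{N}$ is computable if its indicator function is computable. Computable spaces and groups. An indexing of a set $X$ is an injective map $\imath:X\to\mathbb{N}$ with $\imath(X)$ a computable subset of $\mathbb{N}$; $(X,\imath)$ is then a computable space ($\mathbb{N}$ carries the identity indexing). Functions between (products of) computable spaces are computable if the induced functions on indices are computable. A computable group is a pair $(\Gamma,\imath)$ of a group $\Gamma$ and an indexing $\imath$ such that multiplication $\Gamma\times\Gamma\to\Gamma$ is computable. A sequence $(Z_n)_{n\ge1}$ of subsets of $\Gamma$ is computable if $(n,x)\mapsto\mathbf{1}_{Z_n}(x)$ is computable on $\mathbb{N}\times\Gamma$. A sequence $(F_n)_{n\ge1}$ of finite subsets is canonically computable if there is an algorithm that, given $n$, prints the finite set $\imath(F_n)$ and halts (equivalently, $n\mapsto\sum_{x\in \imath(F_n)}2^{x}$ is a total computable function). Følner monotilings. A sequence $(F_n)_{n\ge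 1}$ of finite subsets of $\Gamma$ is a Følner sequence if for every finite $K\subseteq\Gamma$, $|\partial_K(F_n)|/|F_n|\to0$, where $\partial_K(F)=K^{-1}F\cap K^{-1}(\Gamma\setminus F)$ (equivalently, $|F_n\triangle gF_n|/|F_n|\to0$ for every $g\in\Gamma$). A monotiling $[F,\mathcal{Z}]$ of $\Gamma$ is a finite set $F\subseteq\Gamma$ (tile) together with a set $\mathcal{Z}\subseteq\Gamma$ (centers) such that $\{Fz:z\in\mathcal{Z}\}$ is a covering of $\Gamma$ by pairwise disjoint translates of $F$. A Følner monotiling is a sequence of monotilings $([F_n,\mathcal{Z}_n])_{n\ge1}$ with $(F_n)$ a Følner sequence. It is normal if $|F_n|/\log n\to\infty$ as $n\to\infty$ and $\mathrm{e}\in F_n$ for every $n$. It is computable if $(F_n)$ is canonically computable and $(\mathcal{Z}_n)$ is computable. *)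

(* Defs.v *)
From HB Require Import structures.
From mathcomp Require Import all_boot all_order all_algebra finmap.
From mathcomp Require Import all_classical all_reals all_analysis.

Set Implicit Arguments.
Unset Strict Implicit.
Unset Printing Implicit Defensive.

Import numFieldNormedType.Exports.
Local Open Scope classical_set_scope.
Local Open Scope ring_scope.

(* Programs for Kleene's partial recursive functions; a program of type
   [prog k] takes [k] arguments. [prog_eval p v y] means that [p] halts with
   output [y] on the list of arguments [v]; it is only meaningful when [v] has
   size [k], a condition that the recursive calls preserve. *)

Inductive prog : nat -> Type :=
| Zero k : prog k
| Succ : prog 1
| Proj k : 'I_k -> prog k
| Comp k m : prog m -> ('I_m -> prog k) -> prog k
| PrimRec k : prog k -> prog k.+2 -> prog k.+1
| Mu k : prog k.+1 -> prog k.

(* graph of primitive recursion, with the recursion argument first: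
   [base] relates to the value at 0, [step m z] to the value at [m.+1] when
   [z] is the value at [m] *)
Fixpoint primrec_graph (base : nat -> Prop) (step : nat -> nat -> nat -> Prop)
    (n y : nat) : Prop :=
  if n is m.+1 then exists2 z, primrec_graph base step m z & step m z y
  else base y.

Fixpoint prog_eval k (p : prog k) (v : seq nat) (y : nat) : Prop :=
  match p with
  | Zero _ => y = 0%N
  | Succ => y = (head 0%N v).+1
  | Proj _ i => y = nth 0%N v i
  | Comp _ m f g => exists w : seq nat,
      [/\ size w = m, forall i : 'I_m, prog_eval (g i) v (nth 0%N w i)
        & prog_eval f w y]
  | PrimRec _ f g =>
      primrec_graph (prog_eval f (behead v))
        (fun m z => prog_eval g [:: m, z & behead v]) (head 0%N v) y
  (* the values at all smaller arguments must be defined and nonzero *)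
  | Mu _ f => prog_eval f (y :: v) 0%N /\
      forall j, (j < y)%N -> exists z, prog_eval f (j :: v) z.+1
  end.

(* the natural numbers start at 1 *)
Record posnat := PNat { pval :> nat; pval_gt0 : (0 < pval)%N }.

HB.instance Definition _ := [isSub for pval].
HB.instance Definition _ := [Countable of posnat by <:].

(* [psucc k] for k = 0, 1, ... enumerates posnat increasingly *)
Definition psucc (k : nat) : posnat := PNat (ltn0Sn k).

Definition computable_subset (A : set posnat) : Prop :=
  exists p : prog 1, forall n : posnat,
    prog_eval p [:: pval n] (`[< A n >] : nat).

Definition indexing (X : Type) (iX : X -> posnat) : Prop :=
  injective iX /\ computable_subset (range iX).

(* The induced function on indices lives on the image of the indexing; since
   this image is computable, nothing is required of the program elsewhere. *)
Definition computable_fun (X Y : Type) (iX : X -> posnat) (iY : Y -> posnat)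
    (f : X -> Y) : Prop :=
  exists p : prog 1, forall x, prog_eval p [:: pval (iX x)] (iY (f x)).

Definition computable_fun2 (X Y Z : Type) (iX : X -> posnat) (iY : Y -> posnat)
    (iZ : Z -> posnat) (f : X -> Y -> Z) : Prop :=
  exists p : prog 2, forall x y,
    prog_eval p [:: pval (iX x); pval (iY y)] (iZ (f x y)).

Definition computable_group (G : groupType) (iG : G -> posnat) : Prop :=
  indexing iG /\ computable_fun2 iG iG iG (fun x y => (x * y)%g).

Definition computable_set_seq (X : Type) (iX : X -> posnat)
    (Z : posnat -> set X) : Prop :=
  exists p : prog 2, forall (n : posnat) (x : X),
    prog_eval p [:: pval n; pval (iX x)] (`[< Z n x >] : nat).

Definition fset_code (A : {fset nat}) : nat := (\sum_(k <- A) 2 ^ k)%N.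

Definition canonically_computable (X : choiceType) (iX : X -> posnat)
    (F : posnat -> {fset X}) : Prop :=
  exists p : prog 1, forall n : posnat,
    prog_eval p [:: pval n] (fset_code [fset pval (iX x) | x in F n]%fset).

Definition ftranslate (G : groupType) (F : {fset G}) (g : G) : {fset G} :=
  [fset (x * g)%g | x in F]%fset.

Definition ltranslate (G : groupType) (g : G) (Z : set G) : set G :=
  [set (g * z)%g | z in Z].

(* K^-1 F `&` K^-1 (~` F) *)
Definition boundary (G : groupType) (K F : {fset G}) : set G :=
  [set (k^-1 * x)%g | k in [set` K] & x in [set` F]] `&`
  [set (k^-1 * x)%g | k in [set` K] & x in ~` [set` F]].

(* [boundary K F] is finite, so [fset_set] does not take its default value *)
Definition folner_seq (R : realType) (G : groupType)
    (F : posnat -> {fset G}) : Prop :=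
  forall K : {fset G},
    (#|` fset_set (boundary K (F (psucc k)))|%:R / #|` F (psucc k)|%:R : R)
      @[k --> \oo] --> (0 : R).

Definition monotiling (G : groupType) (F : {fset G}) (Z : set G) : Prop :=
  \bigcup_(z in Z) [set` ftranslate F z] = [set: G] /\
  trivIset Z (fun z => [set` ftranslate F z]).

Definition folner_monotiling (R : realType) (G : groupType)
    (F : posnat -> {fset G}) (Z : posnat -> set G) : Prop :=
  (forall n, monotiling (F n) (Z n)) /\ folner_seq R F.

Definition normal_tiling (R : realType) (G : groupType)
    (F : posnat -> {fset G}) : Prop :=
  (#|` F (psucc k)|%:R / ln (psucc k)%:R : R) @[k --> \oo] --> +oo_R /\
  forall n, (1%g : G) \in F n.

Definition computable_tiling (G : groupType) (iG : G -> posnat)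
    (F : posnat -> {fset G}) (Z : posnat -> set G) : Prop :=
  canonically_computable iG F /\ computable_set_seq iG Z.

(* Main.v *)
Require Import Defs.
From mathcomp Require Import all_boot all_order all_algebra finmap.
From mathcomp Require Import all_classical all_reals all_analysis.

(** Translating a tile on the right changes neither its cardinality nor that of
its boundaries, and [F g^-1, g Z] has the same translates as [F, Z]. Hence only
two things have to be arranged: a subsequence along which the tiles grow fast
enough, and one element [r n] of each tile [F n], which puts the identity into
[F n * (r n)^-1].

Growth comes for free. If [#|F| < #|K|] and [k * g] is in [F] for some [k] in
[K], then [l * g] is outside [F] for another [l] in [K]; so the [K]-boundary of
a nonempty small tile is nonempty ([boundary_neq0]). As the group is infinite,
[K] can be as large as needed, so the ratio in the Folner condition cannot tend
to 0 along tiles of bounded size: [#|F n| --> \oo] ([folner_card_cvg]). So for every [i] there is an [n]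
with [i <= n] and [i ^ 2 <= #|F n|], and the least such [n] is found by
unbounded search ([computable_subsequence]). The bound [i <= n i] makes the new
sequence inherit the Folner property, and [i ^ 2 / ln i >= i], for [i > 1],
makes it normal.

The rest is recursion theory. A program given by the hypotheses is guaranteed
to halt only on indices of elements, whereas searches and bounded sums run over
all natural numbers. A computable set of indices admits a computable
retraction of [nat] onto it ([computable_retraction]), and precomposing with it
makes every program total. One can then work with total functions only, for
which the operations needed are: sums over the finite set with a given code
([computable_sum_fset]), which yield cardinalities and the codes of translates;
the search for the least bit of a code, which yields [r]
([computable_element]); and the search for an inverse in the group
([computable_group_inv]). *)

Import Order.TTheory GRing.Theory Num.Theory.
Local Open Scope classical_set_scope.

(** * Total computable functions *)

(** The entries of the list [v] play the role of variables, so that compound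
expressions in these variables need no separate function for each arity. *)
Definition computable k (f : seq nat -> nat) : Prop :=
  exists p : prog k, forall v, size v = k -> prog_eval p v (f v).

(** Only the values of the program at the tuples [[seq g v | g <- gs]] matter, so
this also applies to a program that may diverge elsewhere. *)
Lemma computable_comp {k m} (p : prog m) (gs : seq (seq nat -> nat)) h :
  size gs = m -> {in gs, forall g, computable k g} ->
  (forall v, size v = k -> prog_eval p [seq g v | g <- gs] (h v)) ->
  computable k h.
Proof.
move=> gsm gsP pP; case: m / gsm in p pP *.
have {}gsP i : exists q : prog k, (i < size gs)%N ->
    forall v, size v = k -> prog_eval q v (nth (fun=> 0%N) gs i v).
  case: (ltnP i (size gs)) => [ilt|_]; last by exists (Zero k).
  have [q qP] := gsP _ (mem_nth (fun=> 0%N) ilt).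
  by exists q.
have [q qP] := choice gsP.
exists (Comp p (fun i => q (val i))) => v vk /=.
exists [seq g v | g <- gs]; split; first by rewrite size_map.
  by move=> i; rewrite (nth_map (fun=> 0%N)) ?ltn_ord//; exact: qP.
exact: pP.
Qed.

Lemma computable_proj {k} i : (i < k)%N -> computable k (fun v => nth 0%N v i).
Proof. by move=> ik; exists (Proj (Ordinal ik)). Qed.

Lemma computable_subst {k m f} (gs : seq (seq nat -> nat)) :
  computable m f -> size gs = m -> {in gs, forall g, computable k g} ->
  computable k (fun v => f [seq g v | g <- gs]).
Proof.
move=> [p pP] gsm gsP; apply: (computable_comp p gs _ gsm gsP) => v _.
by apply: pP; rewrite size_map.
Qed.

Lemma computable_comp1 {k f g} : computable 1 f -> computable k g ->
  computable k (fun v => f [:: g v]).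
Proof.
move=> fP gP; apply: (computable_subst [:: g] fP) => // h.
by rewrite inE => /eqP ->.
Qed.

Lemma computable_comp2 {k f g h} : computable 2 f -> computable k g ->
  computable k h -> computable k (fun v => f [:: g v; h v]).
Proof.
move=> fP gP hP; apply: (computable_subst [:: g; h] fP) => // x.
by rewrite !inE => /orP[] /eqP ->.
Qed.

Lemma eq_computable {k} f g :
  (forall v, size v = k -> f v = g v) -> computable k f -> computable k g.
Proof. by move=> fg [p pP]; exists p => v vk; rewrite -fg //; exact: pP. Qed.

(** The first [j] variables are replaced by the expressions [gs] and the others
are kept: this serves for substitution under a binder and for weakening. *)
Lemma computable_env {k m f} (gs : seq (seq nat -> nat)) j :
  (size gs + k)%N = m -> computable m f ->
  {in gs, forall g, computable (j + k)%N g} ->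
  computable (j + k)%N (fun v => f ([seq g v | g <- gs] ++ drop j v)).
Proof.
move=> km fP gsP.
pose ps := [seq (fun v => nth 0%N v i) | i <- iota j k].
apply: eq_computable (computable_subst (gs ++ ps) fP _ _) => [v vk||g].
- rewrite map_cat -map_comp; congr (f (_ ++ _)).
  transitivity [seq nth 0%N v i | i <- iota j k]; first by [].
  by rewrite map_nth_iota ?vk ?addKn // take_oversize // size_drop vk addKn.
- by rewrite size_cat size_map size_iota.
- rewrite mem_cat => /orP[/gsP//|/mapP[i]]; rewrite mem_iota => /andP[_ ik] ->.
  exact: computable_proj.
Qed.

Lemma computable_rec {k b s g} :
  computable k b -> computable k.+2 s -> computable k g ->
  computable k (fun v => nat_rec (fun=> nat) (b v)
                           (fun m z => s [:: m, z & v]) (g v)).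
Proof.
move=> [pb pbP] [ps psP] gP.
have rP : computable k.+1 (fun v => nat_rec (fun=> nat) (b (behead v))
    (fun m z => s [:: m, z & behead v]) (head 0%N v)).
  exists (PrimRec pb ps) => -[//|n v] /= [vk].
  elim: n => [|n IHn] /=; first exact: pbP.
  by eexists; [exact: IHn | apply: psP; rewrite /= vk].
have := @computable_env k k.+1 _ [:: g] 0 erefl rP.
rewrite add0n => H; apply: eq_computable (H _) => [v _|h].
  by rewrite /= drop0.
by rewrite inE => /eqP ->.
Qed.

(** Totality of [f] makes the search pass through all smaller arguments, and the
existence of zeros makes it halt; so the result is again total. *)
Lemma computable_mu {k f} :
  computable k.+1 f -> (forall v, exists y, f (y :: v) = 0%N) ->
  exists2 g, computable k g & forall v, f (g v :: v) = 0%N.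
Proof.
move=> [p pP] ex.
have {}ex v : exists y, f (y :: v) == 0%N by have [y /eqP] := ex v; exists y.
exists (fun v => ex_minn (ex v)) => [|v]; last by case: ex_minnP => y /eqP.
exists (Mu p) => v vk /=; case: ex_minnP => y /eqP fy ymin.
have {}pP j : prog_eval p (j :: v) (f (j :: v)) by apply: pP; rewrite /= vk.
split=> [|j jy]; first by rewrite -fy.
exists (f (j :: v)).-1; rewrite prednK // lt0n.
by apply: contraL jy => /ymin; rewrite -leqNgt.
Qed.

Lemma computableS {k f} : computable k f -> computable k (fun v => (f v).+1).
Proof.
move=> fP; apply: (@computable_comp1 k (fun v => (head 0%N v).+1)) fP.
by exists Succ.
Qed.

Lemma computableC {k} c : computable k (fun=> c).
Proof. by elim: c => [|c /computableS//]; exists (Zero k). Qed.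

Lemma computableD {k f g} : computable k f -> computable k g ->
  computable k (fun v => f v + g v)%N.
Proof.
move=> fP gP; have sP := computableS (@computable_proj k.+2 1 isT).
apply: eq_computable (computable_rec gP sP fP) => v _.
by elim: (f v) => //= n ->; rewrite addSn.
Qed.

Lemma computable_pred {k f} :
  computable k f -> computable k (fun v => (f v).-1).
Proof.
move=> fP; have sP := @computable_proj k.+2 0 isT.
by apply: eq_computable (computable_rec (computableC 0) sP fP) => v _;
  case: (f v).
Qed.

Lemma computableB {k f g} : computable k f -> computable k g ->
  computable k (fun v => f v - g v)%N.
Proof.
move=> fP gP; have sP := computable_pred (@computable_proj k.+2 1 isT).
apply: eq_computable (computable_rec fP sP gP) => v _.
by elim: (g v) => [|n /= ->]; rewrite ?subn0 // subnS.
Qed.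

Lemma computableM {k f g} : computable k f -> computable k g ->
  computable k (fun v => f v * g v)%N.
Proof.
apply: (@computable_comp2 k (fun v => nth 0 v 0 * nth 0 v 1)%N).
have sP := computableD (@computable_proj 4 1 isT) (@computable_proj 4 3 isT).
apply: eq_computable
  (computable_rec (computableC 0) sP (@computable_proj 2 0 isT)) => v _ /=.
by elim: (nth _ _ 0) => //= n ->; rewrite mulSn addnC.
Qed.

Lemma computable_exp2 {k f} :
  computable k f -> computable k (fun v => 2 ^ f v)%N.
Proof.
move=> fP; have zP := @computable_proj k.+2 1 isT.
apply: eq_computable
  (computable_rec (computableC 1) (computableD zP zP) fP) => v _.
by elim: (f v) => //= n ->; rewrite expnS mul2n addnn.
Qed.

Lemma computable_odd {k f} :
  computable k f -> computable k (fun v => odd (f v) : nat).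
Proof.
move=> fP; have zP := @computable_proj k.+2 1 isT.
apply: eq_computable
  (computable_rec (computableC 0) (computableB (computableC 1) zP) fP) => v _.
by elim: (f v) => //= n ->; case: (odd n).
Qed.

Lemma computable_half {k f} :
  computable k f -> computable k (fun v => (f v)./2).
Proof.
move=> fP; have nP := @computable_proj k.+2 0 isT.
have zP := @computable_proj k.+2 1 isT.
apply: eq_computable
  (computable_rec (computableC 0) (computableD (computable_odd nP) zP) fP)
  => v _.
by elim: (f v) => //= n ->; rewrite uphalf_half.
Qed.

(** * Finite sets coded by binary expansions *)

Definition bit c b : bool := odd (c %/ 2 ^ b).

Lemma computable_bit {k f g} : computable k f -> computable k g ->
  computable k (fun v => bit (f v) (g v) : nat).
Proof.
move=> fP gP; have zP := @computable_proj k.+2 1 isT.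
apply: eq_computable
  (computable_odd (computable_rec fP (computable_half zP) gP)) => v _.
congr (nat_of_bool (odd _)); elim: (g v) => [|n /= ->]; first by rewrite divn1.
by rewrite -divn2 -divnMA expnSr.
Qed.

Lemma computable_sum {k f g} : computable k.+1 f -> computable k g ->
  computable k (fun v => \sum_(i < g v) f ((i : nat) :: v))%N.
Proof.
move=> fP gP.
have fP2 := @computable_env k k.+1 f [:: fun v => nth 0%N v 0] 2 erefl fP.
(* in the step, variable 0 is the counter and variable 1 the partial sum *)
have sP : computable k.+2
    (fun v => nth 0%N v 1 + f (nth 0%N v 0 :: drop 2 v))%N.
  apply: computableD (@computable_proj k.+2 1 isT) (fP2 _) => g'.
  by rewrite inE => /eqP ->; exact: computable_proj.
apply: eq_computable (computable_rec (computableC 0) sP gP) => v _.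
elim: (g v) => [|n /= ->]; first by rewrite big_ord0.
by rewrite big_ord_recr /= drop0.
Qed.

Lemma sum_fset_ord (A : {fset nat}) n (g : nat -> nat) :
  (forall k, k \in A -> (k < n)%N) ->
  (\sum_(k <- A) g k = \sum_(k < n) ((k : nat) \in A) * g k)%N.
Proof.
move=> An; rewrite -(big_mkord xpredT (fun k => (k \in A) * g k)%N).
under [RHS]eq_bigr => k _ do rewrite mulnbl.
rewrite -big_mkcond -[RHS]big_filter /=; apply: perm_big.
apply: uniq_perm; rewrite ?filter_uniq ?iota_uniq ?fset_uniq // => k.
rewrite mem_filter mem_index_iota /=.
by case kA: (k \in A); rewrite /= ?(An k kA).
Qed.

Lemma bit_sum n (a : nat -> bool) b :
  bit (\sum_(k < n) a k * 2 ^ k)%N b = (b < n)%N && a b.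
Proof.
elim: b n a => [|b IHb] [|n] a; rewrite ?big_ord0 /bit ?div0n //.
all: rewrite big_ord_recl muln1; under eq_bigr => k _ do rewrite expnS mulnCA.
all: rewrite -big_distrr /= mul2n.
  by rewrite divn1 oddD odd_double addbF oddb.
by rewrite expnS divnMA divn2 half_bit_double; exact: (IHb n (fun k => a k.+1)).
Qed.

(** The code of a set thereby serves as the bound that turns a sum over the set
into a bounded sum. *)
Lemma fset_code_gt (A : {fset nat}) k : k \in A -> (k < fset_code A)%N.
Proof.
move=> kA; apply: leq_trans (ltn_expl k (isT : 1 < 2)%N) _.
by rewrite /fset_code (big_rem k) //= leq_addr.
Qed.

Lemma bit_fset_code (A : {fset nat}) b : bit (fset_code A) b = (b \in A).
Proof.
have An k : k \in A -> (k < fset_code A)%N by exact: fset_code_gt.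
rewrite {1}/fset_code (@sum_fset_ord A (fset_code A)) //.
rewrite (bit_sum _ (fun k => k \in A)).
by case bA: (b \in A); rewrite ?andbF // An.
Qed.

Lemma sum_bit_fset_code (A : {fset nat}) (g : nat -> nat) :
  (\sum_(k < fset_code A) bit (fset_code A) k * g k = \sum_(k <- A) g k)%N.
Proof.
rewrite (@sum_fset_ord A (fset_code A)) => [|k]; last exact: fset_code_gt.
by under eq_bigr => k _ do rewrite bit_fset_code.
Qed.

(** * Functions on computable spaces *)

Lemma computable_weaken {k f} :
  computable k f -> computable k.+1 (fun v => f (behead v)).
Proof.
move=> fP; apply: eq_computable (@computable_env k k f [::] 1 erefl fP _) => //.
by move=> v _; rewrite drop1.
Qed.

Lemma computable_app1 {k} {X : Type} {iX : X -> posnat} {h : X -> nat}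
    {a : seq nat -> X} :
  (exists p : prog 1, forall x, prog_eval p [:: pval (iX x)] (h x)) ->
  computable k (fun v => iX (a v)) -> computable k (fun v => h (a v)).
Proof.
move=> [p pP] aP.
apply: (computable_comp p [:: fun v => pval (iX (a v))]) => [//|g|v _].
  by rewrite inE => /eqP ->.
exact: pP.
Qed.

Lemma computable_app2 {k} {X Y : Type} {iX : X -> posnat} {iY : Y -> posnat}
    {h : X -> Y -> nat} {a : seq nat -> X} {b : seq nat -> Y} :
  (exists p : prog 2, forall x y,
    prog_eval p [:: pval (iX x); pval (iY y)] (h x y)) ->
  computable k (fun v => iX (a v)) -> computable k (fun v => iY (b v)) ->
  computable k (fun v => h (a v) (b v)).
Proof.
move=> [p pP] aP bP.
apply: (computable_comp p
  [:: fun v => pval (iX (a v)); fun v => pval (iY (b v))]) => [//|g|v _].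
  by rewrite !inE => /orP[] /eqP ->.
exact: pP.
Qed.

Definition pos_of (n : nat) : posnat := psucc n.-1.

Lemma pos_ofK (n : posnat) : pos_of n = n.
Proof. by apply: val_inj; rewrite /= prednK // pval_gt0. Qed.

Lemma computable_pos_of {k f} :
  computable k f -> computable k (fun v => pos_of (f v)).
Proof. by move=> /computable_pred /computableS. Qed.

Lemma computable_posnat {h : posnat -> nat} :
  computable 1 (fun v => h (pos_of (nth 0%N v 0))) ->
  exists p : prog 1, forall n : posnat, prog_eval p [:: pval n] (h n).
Proof.
move=> [p pP]; exists p => n.
by have := pP [:: pval n] erefl; rewrite pos_ofK.
Qed.

(** The retraction sends a number that is not an index to [x0]. Since membership
in the range of the indexing is decidable, the case distinction is an
arithmetical expression in the characteristic function. *)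
Lemma computable_retraction {X : Type} {iX : X -> posnat} (x0 : X) :
  indexing iX ->
  exists rho : nat -> X, (forall x, rho (iX x) = x) /\
    forall k f, computable k f -> computable k (fun v => iX (rho (f v))).
Proof.
move=> [iXinj iXrange].
have /choice[rho0 rho0P] (n : posnat) : exists x, range iX n -> iX x = n.
  by have [[x _ <-]|] := pselect (range iX n); [exists x | exists x0].
pose rho (n : posnat) := if `[< range iX n >] then rho0 n else x0.
have rhoE n : pval (iX (rho n)) =
    (`[< range iX n >] * pval n + (1 - `[< range iX n >]) * pval (iX x0))%N.
  rewrite /rho; case: asboolP => [/rho0P ->|_] /=; first by rewrite mul1n addn0.
  by rewrite mul0n mul1n.
exists (fun n => rho (pos_of n)); split=> [x|k f fP].
  rewrite pos_ofK /rho; case: asboolP => [/rho0P /iXinj//|[]].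
  by exists x.
have nP := computable_pos_of fP.
have cP := @computable_app1 k _ id _ (fun v => pos_of (f v)) iXrange nP.
apply: eq_computable (computableD (computableM cP nP)
  (computableM (computableB (computableC 1) cP) (computableC (iX x0)))) => v _.
by rewrite rhoE.
Qed.

Lemma computable_group_mul {k} {G : groupType} {iG : G -> posnat}
    {a b : seq nat -> G} :
  computable_group iG ->
  computable k (fun v => iG (a v)) -> computable k (fun v => iG (b v)) ->
  computable k (fun v => iG (a v * b v)%g).
Proof. by move=> [_ mP] aP; exact: (computable_app2 mP aP). Qed.

(** Only multiplication is assumed computable; the inverse is found by searching
for a number [y] that decodes to a solution of [a * y = 1]. *)
Lemma computable_group_inv {k} {G : groupType} {iG : G -> posnat}
    {a : seq nat -> G} :
  computable_group iG ->
  computable k (fun v => iG (a v)) -> computable k (fun v => iG (a v)^-1%g).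
Proof.
move=> GP aP; have [iGP _] := GP.
have [rho [rhoK rhoP]] := computable_retraction (1%g : G) iGP.
have mP := computable_group_mul GP (computable_weaken aP)
             (rhoP _ _ (@computable_proj k.+1 0 isT)).
have eP := @computableC k.+1 (iG 1%g).
have [|g gP g0] := computable_mu (computableD (computableB mP eP)
                                              (computableB eP mP)).
  by move=> v; exists (iG (a v)^-1%g); rewrite /= rhoK mulgV !subnn.
apply: eq_computable (rhoP _ _ gP) => v _.
have /eqP := g0 v; rewrite /= addn_eq0 !subn_eq0 -eqn_leq => /eqP /val_inj.
by move=> /iGP.1 /mulg1_eq ->.
Qed.

Lemma computable_code {X : choiceType} {iX : X -> posnat}
    {F : posnat -> {fset X}} {k} {a : seq nat -> posnat} :
  canonically_computable iX F -> computable k (fun v => a v) ->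
  computable k (fun v => fset_code [fset pval (iX x) | x in F (a v)]%fset).
Proof. by move=> FP; exact: (@computable_app1 _ _ id _ _ FP). Qed.

Lemma sum_index {X : choiceType} {iX : X -> posnat} (A : {fset X})
    (g : nat -> nat) : injective iX ->
  (\sum_(k <- [fset pval (iX x) | x in A]%fset) g k = \sum_(x <- A) g (iX x))%N.
Proof. by move=> iXinj; rewrite big_imfset //= => x y _ _ /val_inj /iXinj. Qed.

Lemma computable_sum_fset {X : choiceType} {iX : X -> posnat}
    {F : posnat -> {fset X}} {k} {a : seq nat -> posnat} {g : seq nat -> nat} :
  injective iX -> canonically_computable iX F ->
  computable k (fun v => a v) -> computable k.+1 g ->
  computable k (fun v => \sum_(x <- F (a v)) g (pval (iX x) :: v))%N.
Proof.
move=> iXinj FP aP gP; have cP := computable_code FP aP.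
apply: eq_computable (computable_sum (computableM (computable_bit
  (computable_weaken cP) (@computable_proj k.+1 0 isT)) gP) cP) => v _ /=.
by rewrite (sum_bit_fset_code _ (fun i => g (i :: v)))
  (sum_index _ (fun i => g (i :: v))).
Qed.

Lemma computable_card {X : choiceType} {iX : X -> posnat}
    {F : posnat -> {fset X}} {k} {a : seq nat -> posnat} :
  injective iX -> canonically_computable iX F ->
  computable k (fun v => a v) -> computable k (fun v => #|` F (a v)|).
Proof.
move=> iXinj FP aP.
apply: eq_computable (computable_sum_fset iXinj FP aP (computableC 1)) => v _.
by rewrite big_const_seq count_predT iter_addn_0 mul1n.
Qed.

(** The element of least index is selected: its index is the position of the
lowest bit in the code of [F n]. *)
Lemma computable_element {X : choiceType} {iX : X -> posnat}
    {F : posnat -> {fset X}} :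
  indexing iX -> canonically_computable iX F ->
  (forall n, exists x, x \in F n) ->
  exists2 r : posnat -> X, computable_fun id iX r & forall n, r n \in F n.
Proof.
move=> iXP FP ex.
have [x0 _] := ex (psucc 0).
have [rho [rhoK rhoP]] := computable_retraction x0 iXP.
have nP := computable_pos_of (@computable_proj 1 0 isT).
have cP := computable_weaken (computable_code FP nP).
have [|g gP g0] := computable_mu (computableB (@computableC 2 1)
    (computable_bit cP (@computable_proj 2 0 isT))).
  move=> v; have [x xF] := ex (pos_of (nth 0%N v 0)).
  exists (iX x); rewrite /= bit_fset_code.
  by case: imfsetP => // -[]; exists x.
have rP n : rho (g [:: pval n]) \in F n.
  have := g0 [:: pval n]; rewrite /= bit_fset_code pos_ofK.
  by case: imfsetP => //= -[x xF -> _]; rewrite rhoK.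
exists (fun n => rho (g [:: pval n])) => //; apply: computable_posnat.
apply: (rhoP 1%N (fun v => g [:: pval (pos_of (nth 0%N v 0))])).
exact: computable_comp1 gP nP.
Qed.

Lemma canonically_computable_comp {X : choiceType} {iX : X -> posnat}
    {F : posnat -> {fset X}} {n : posnat -> posnat} :
  canonically_computable iX F -> computable_fun id id n ->
  canonically_computable iX (fun i => F (n i)).
Proof.
move=> FP nP; apply: computable_posnat; apply: computable_code FP _.
apply: (computable_app1 nP).
exact: computable_pos_of (@computable_proj 1 0 isT).
Qed.

(** The code of [F i * g i] is the sum of [2 ^ k] over the indices [k] of the
elements [x * g i], without repetition because right translation is
injective. *)
Lemma canonically_computable_translate {G : groupType} {iG : G -> posnat}
    {F : posnat -> {fset G}} {g : posnat -> G} :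
  computable_group iG -> canonically_computable iG F ->
  computable_fun id iG g ->
  canonically_computable iG (fun i => ftranslate (F i) (g i)).
Proof.
move=> GP FP gP; apply: computable_posnat.
have [[iGinj _] _] := GP.
have [rho [rhoK rhoP]] := computable_retraction (1%g : G) GP.1.
have nP := computable_pos_of (@computable_proj 1 0 isT).
have tP := computable_exp2 (computable_group_mul GP
  (rhoP _ _ (@computable_proj 2 0 isT))
  (computable_weaken (computable_app1 gP nP))).
apply: eq_computable (computable_sum_fset iGinj FP nP tP) => v _ /=.
rewrite /fset_code (sum_index _ (expn 2)) // /ftranslate big_imfset /=.
  by apply: eq_bigr => x _; rewrite rhoK.
by move=> x y _ _ /mulIg.
Qed.

(** Membership of [x] in [g Z] is membership of [g^-1 * x] in [Z]. *)
Lemma computable_set_seq_translate {G : groupType} {iG : G -> posnat}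
    {Z : posnat -> set G} {g : posnat -> G} {n : posnat -> posnat} :
  computable_group iG -> computable_set_seq iG Z ->
  computable_fun id iG g -> computable_fun id id n ->
  computable_set_seq iG (fun i => ltranslate (g i) (Z (n i))).
Proof.
move=> GP ZP gP nP.
have [rho [rhoK rhoP]] := computable_retraction (1%g : G) GP.1.
have iP := computable_pos_of (@computable_proj 2 0 isT).
have xP := rhoP _ _ (@computable_proj 2 1 isT).
have giP := computable_group_inv GP (computable_app1 gP iP).
have [p pP] := @computable_app2 _ _ _ id _ _ _ _ ZP (computable_app1 nP iP)
   (computable_group_mul GP giP xP).
exists p => i x; have := pP [:: pval i; pval (iG x)] erefl.
rewrite /= pos_ofK rhoK; congr (prog_eval _ _ (nat_of_bool _)).
apply: asbool_equiv_eq; split=> [Zx|[z Zz <-]]; last by rewrite mulKg.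
by exists ((g i)^-1 * x)%g => //; rewrite mulVKg.
Qed.

(** * Translates, boundaries and growth of tiles *)

Lemma card_ftranslate {G : groupType} (F : {fset G}) g :
  #|` ftranslate F g| = #|` F|.
Proof. exact/card_imfset/mulIg. Qed.

Lemma boundary_translate {G : groupType} (K F : {fset G}) g :
  boundary K (ftranslate F g) = [set (x * g)%g | x in boundary K F].
Proof.
have FP x : (x * g \in ftranslate F g)%g = (x \in F).
  by apply/imfsetP/idP => [[y yF /mulIg ->]//|xF]; exists x.
rewrite seteqP; split=> [t|u [t]].
  move=> [[k kK [_ /imfsetP[x /= xF ->] <-]] [l lK [y yF]]]; rewrite mulgA => e.
  exists (k^-1 * x)%g => //; split; first by exists k => //; exists x.
  exists l => //; exists (y * g^-1)%g; last by rewrite mulgA e mulgK.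
  by move=> /=; rewrite -FP mulgVK.
move=> [[k kK [x xF <-]] [l lK [y yF e]]] <-; split.
  by exists k => //; exists (x * g)%g; rewrite ?mulgA //= FP.
by exists l => //; exists (y * g)%g; rewrite ?mulgA ?e //= FP.
Qed.

Lemma finite_boundary {G : groupType} (K F : {fset G}) :
  finite_set (boundary K F).
Proof.
apply: sub_finite_set (@subIsetl _ _ _) _.
by apply: finite_image2; exact: finite_fset.
Qed.

Lemma card_boundary_translate {G : groupType} (K F : {fset G}) g :
  #|` fset_set (boundary K (ftranslate F g))| = #|` fset_set (boundary K F)|.
Proof.
rewrite boundary_translate fset_set_image; last exact: finite_boundary.
exact/card_imfset/mulIg.
Qed.

Lemma monotiling_translate {G : groupType} (F : {fset G}) (Z : set G) (g : G) :
  monotiling F Z -> monotiling (ftranslate F g^-1%g) (ltranslate g Z).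
Proof.
have FE z : ftranslate (ftranslate F g^-1%g) (g * z)%g = ftranslate F z.
  rewrite /ftranslate -imfset_comp; apply: eq_imfset => //= x.
  by rewrite /= mulgA mulgVK.
move=> [cover disj]; split; last first.
  apply: trivIset_image.
  rewrite (_ : _ \o _ = fun z => [set` ftranslate F z]) //.
  by apply/funext => z /=; rewrite FE.
by rewrite bigcup_image -cover; apply: eq_bigcupr => z _; rewrite FE.
Qed.

Lemma monotiling_nonempty {G : groupType} (F : {fset G}) (Z : set G) :
  monotiling F Z -> exists x, x \in F.
Proof.
move=> [cover _].
have [z _ /imfsetP[x xF _]] : (\bigcup_(z in Z) [set` ftranslate F z]) 1%g.
  by rewrite cover.
by exists x.
Qed.

(** Take [k] in [K], [x] in [F] and [g = k^-1 * x]. The translate [K * g] has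
too many elements to lie in [F], so some [l * g] is outside [F], and then [g]
is in the boundary. *)
Lemma boundary_neq0 {G : groupType} (K F : {fset G}) :
  (exists x, x \in F) -> (#|` F| < #|` K|)%N ->
  (0 < #|` fset_set (boundary K F)|)%N.
Proof.
move=> [x xF] FK; rewrite cardfs_gt0.
have [k kK] : exists k, k \in K.
  by apply/fset0Pn; rewrite -cardfs_gt0; exact: leq_ltn_trans FK.
set g := (k^-1 * x)%g.
have [sub|] := boolP (ftranslate K g `<=` F)%fset.
  have := fsubset_leq_card sub.
  by rewrite card_ftranslate leqNgt FK.
move=> /fsubsetPn[_ /imfsetP[l /= lK ->] lgF].
apply/fset0Pn; exists g; rewrite in_fset_set; last exact: finite_boundary.
rewrite inE; split; first by exists k => //; exists x.
by exists l => //; exists (l * g)%g; [exact/negP | rewrite mulKg].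
Qed.

(** Fix [K] with more than [m] elements. If [#|F n| <= m], the [K]-boundary
of [F n] has at least one element, a proportion of at least [1 / m.+1]; for
large [n] the Folner condition excludes this. *)
Lemma folner_card_cvg {R : realType} {G : groupType} (F : posnat -> {fset G}) :
  infinite_set [set: G] -> folner_seq R F ->
  (forall n, exists x, x \in F n) ->
  #|` F (psucc k)| @[k --> \oo] --> \oo.
Proof.
move=> infG FP ex; apply/cvgnyPgt => m.
have [K _ mK] := infinite_set_fset m.+1 infG.
have m0 : (0 < (m.+1)%:R^-1 :> R)%R by rewrite invr_gt0.
near=> k; rewrite ltnNge; apply/negP => Fm.
suff : (m.+1%:R^-1 <= (#|` fset_set (boundary K (F (psucc k)))|%:R
    / #|` F (psucc k)|%:R : R))%R.
  apply/negP; rewrite -ltNge; near: k.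
  have /cvgrPdist_lt/(_ _ m0) := FP K.
  by apply: filterS => k; rewrite sub0r normrN ger0_norm ?divr_ge0.
have Fgt0 : (0 < #|` F (psucc k)|)%N.
  by rewrite cardfs_gt0; apply/fset0Pn; exact: ex.
rewrite -[X in (X <= _)%R]mul1r ler_pM ?ler1n //.
  by apply: boundary_neq0 (ex _) _; exact: leq_ltn_trans Fm mK.
by rewrite lef_pV2 ?posrE ?ltr0n // ler_nat leqW.
Unshelve. all: by end_near.
Qed.

(** As [0 < ln x < x] for [x > 1], the ratio is at least the index itself from
the second index on. *)
Lemma normal_of_card_ge_sqr {R : realType} {G : groupType}
    (F : posnat -> {fset G}) :
  (forall n : posnat, (n ^ 2 <= #|` F n|)%N) ->
  (#|` F (psucc k)|%:R / ln (psucc k)%:R : R)%R @[k --> \oo] --> +oo%R.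
Proof.
move=> Fge; apply/cvgryPge => A; near=> k.
have k0 : (0 < k)%N by near: k; exact: nbhs_infty_gt.
have ln0 : (0 < ln ((psucc k)%:R : R))%R by rewrite ln_gt0 // ltr1n.
apply: (@le_trans _ _ ((psucc k)%:R : R)%R).
  apply: (@le_trans _ _ (k%:R : R)%R); last by rewrite ler_nat /=.
  by near: k; exact: nbhs_infty_ger.
rewrite ler_pdivlMr //; apply: (@le_trans _ _ ((psucc k ^ 2)%N%:R)%R).
  rewrite natrX expr2 ler_pM2l ?ltr0n //.
  by apply/ltW/ln_sublinear; rewrite ltr0n.
by rewrite ler_nat.
Unshelve. all: by end_near.
Qed.

Lemma folner_reindex_translate {R : realType} {G : groupType}
    (F : posnat -> {fset G}) (n : posnat -> posnat) (g : posnat -> G) :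
  folner_seq R F -> (forall i : posnat, (i <= n i)%N) ->
  folner_seq R (fun i => ftranslate (F (n i)) (g i)).
Proof.
move=> FP nge K.
under eq_fun do rewrite card_boundary_translate card_ftranslate -[n _]pos_ofK.
(* [psucc] counts from 0, hence the predecessor in the change of index *)
apply: (cvg_comp (fun k => (n (psucc k)).-1)) (FP K).
apply/cvgnyPge => m; near=> k.
rewrite -ltnS prednK ?pval_gt0 //; apply: leq_trans (nge _).
by rewrite ltnS; near: k; exact: nbhs_infty_ge.
Unshelve. all: by end_near.
Qed.

(** The two conditions on [m] amount to the vanishing of
[(i - m) + (b i - #|F m|)], with truncated subtraction, so that a single search
handles both. *)
Lemma computable_subsequence {X : choiceType} {iX : X -> posnat}
    {F : posnat -> {fset X}} (b : nat -> nat) :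
  injective iX -> canonically_computable iX F ->
  computable 1 (fun v => b (nth 0%N v 0)) ->
  #|` F (psucc k)| @[k --> \oo] --> \oo ->
  exists n : posnat -> posnat, [/\ computable_fun id id n,
    forall i : posnat, (i <= n i)%N &
    forall i : posnat, (b i <= #|` F (n i)|)%N].
Proof.
move=> iXinj FP bP Foo.
have mP := @computable_proj 2 0 isT.
have iP := @computable_proj 2 1 isT.
have cP := computable_card iXinj FP (computable_pos_of mP).
have [|g gP g0] := computable_mu (computableD (computableB iP mP)
                                   (computableB (computable_comp1 bP iP) cP)).
  move=> v; have [N _ NP] := (cvgnyPge _).1 Foo (b (nth 0%N v 0)).
  exists (maxn N (nth 0%N v 0)).+1; apply/eqP.
  rewrite /= addn_eq0 !subn_eq0 ltnW ?ltnS ?leq_maxr //.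
  by apply: NP; rewrite /= leq_maxl.
have gE (i : posnat) :
    (i <= g [:: pval i] /\ b i <= #|` F (pos_of (g [:: pval i]))|)%N.
  by have /eqP := g0 [:: pval i]; rewrite /= addn_eq0 !subn_eq0 => /andP.
exists (fun i => pos_of (g [:: pval i])); split=> [|i|i].
- apply: computable_posnat; apply: computable_pos_of.
  exact: computable_comp1 gP (computable_pos_of (@computable_proj 1 0 isT)).
- have [gi _] := gE i.
  by rewrite /= prednK // (leq_trans (pval_gt0 i) gi).
- exact: (gE i).2.
Qed.

Theorem lemma2p8 (R : realType) (G : groupType) (iG : G -> posnat)
    (F : posnat -> {fset G}) (Z : posnat -> set G)
    (hinf : infinite_set [set: G]) (hG : computable_group iG)
    (hFZ : folner_monotiling R F Z) (hcomp : computable_tiling iG F Z) :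
  exists (r : posnat -> G) (n : posnat -> posnat),
    computable_fun id iG r /\
    computable_fun id id n /\
    let F' := fun i => ftranslate (F (n i)) (r (n i))^-1%g in
    let Z' := fun i => ltranslate (r (n i)) (Z (n i)) in
    folner_monotiling R F' Z' /\ normal_tiling R F' /\
    computable_tiling iG F' Z'.
Proof.
have [iGP _] := hG; have [iGinj _] := iGP.
have [tilF folF] := hFZ; have [cF cZ] := hcomp.
have F0 i := monotiling_nonempty (F i) (Z i) (tilF i).
have [r rP rF] := computable_element iGP cF F0.
have xP := @computable_proj 1 0 isT.
have [n [nP nge Fge]] := computable_subsequence (expn^~ 2) iGinj cF
  (computableM xP xP) (folner_card_cvg F hinf folF F0).
have argP := computable_pos_of xP.
have rnP := computable_app1 rP (computable_app1 nP argP).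
exists r, n; do 2 split=> //; split; [split|split; [split|split]].
- by move=> i; exact: monotiling_translate.
- exact: (folner_reindex_translate F n (fun i => (r (n i))^-1%g)).
- apply: (normal_of_card_ge_sqr (fun i => ftranslate (F (n i)) (r (n i))^-1%g)).
  by move=> i; rewrite card_ftranslate.
- by move=> i; apply/imfsetP; exists (r (n i)); rewrite ?mulgV //=.
- apply: (@canonically_computable_translate _ _ _
    (fun i => (r (n i))^-1%g)) => //.
    exact: canonically_computable_comp.
  exact: computable_posnat (computable_group_inv hG rnP).
- apply: (@computable_set_seq_translate _ _ _ (fun i => r (n i))) => //.
  exact: computable_posnat rnP.
Qed.
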